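(* Let $\mathcal T$ be a minimally complete abstract Newton tree at infinity. Let $u\in\mathcal N$ and let $A$ be any subset of $\mathcal E_u$. Then $$R(u,A)+(\epsilon(u)-|A|-1)\Big(1-\frac1{N_u}\Big)=1+\frac{\bar\Delta(u,A)-1-\sum_{e\in A}\eta(u,e)}{N_u}.$$
   Context: **Decorated rooted trees.** A rooted tree is a finite tree with set of cells $X_0$, edges (2-element subsets of $X_0$) and a root $v_0\in X_0$; $\delta_x$ is the valency of $x$, and $\gamma_{x,y}$ the unique path from $x$ to $y$. Arrows: $\mathcal A=\{x:\delta_x=1\}\setminus\{v_0\}$; vertices: $\mathcal V=X_0\setminus\mathcal A$. For distinct $x,y$, $x<y$ means that $x$ is on $\gamma_{v_0,y}$. In a decorated rooted tree, each arrow is decorated by $(0)$ or $(1)$ ($\mathcal A_0$ = set of arrows decorated by $(0)$), and each pair $(e,x)$ with $e$ an edge and $x\in e$ carries an integer $q(e,x)$ (decoration of $e$ near $x$). $Q(e,x)=\prod q(e',x)$ over edges $e'\ne e$ incident to $x$ (empty products are $1$). For an edge $e=\{x,y\}$ with $x,y\in\mathcal V$, $\det(e)=q(e,x)q(e,y)-Q(e,x)Q(e,y)$. A dead end is an edge incident to an element of $\mathcal A_0$. **Abstract Newton tree at infinity**: a decorated rooted tree such that (1) for each $v\in\mathcal V$ some $\alpha\in\mathcal A\setminus\mathcal A_0$ satisfies $\alpha>v$; (2) at most one dead end is incident to a given vertex; (3) $q(e,v_0)=1$ for all edges $e$ incident to $v_0$; (4) $q(e,\alpha)=1$ for every edge $e$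 incident to an arrow $\alpha$; (5) for $v\in\mathcal V$ and distinct edges $e,e'$ incident to $v$, $q(e,v)$ and $q(e',v)$ are coprime; with $E_v^+$ the set of edges $\{v,x\}$ with $v<x$, $q(e,v)\ge1$ for all $e\in E_v^+$, at most one $e\in E_v^+$ has $q(e,v)>1$, and if a dead end $\epsilon$ is incident to $v$ then $q(\epsilon,v)=\max_{e\in E_v^+}q(e,v)$; (6) $\det(e)<0$ for every edge $e$ joining two vertices. For $v\in\mathcal V$, $\alpha\in\mathcal A\setminus\mathcal A_0$: $x_{v,\alpha}$ is the product of $q(\epsilon,u)$ over all edges $\epsilon$ not in $\gamma_{v,\alpha}$ but incident to a cell $u$ of $\gamma_{v,\alpha}$; $N_v=\sum_{\alpha\in\mathcal A\setminus\mathcal A_0}x_{v,\alpha}$. A dicritical vertex is a vertex with $N_v=0$. The tree is **minimally complete** if (i) $N_v\ge0$ for all $v\in\mathcal V$ and each arrow decorated by $(1)$ is adjacent to a dicritical vertex; (ii) a dead end is incident to each dicritical vertex; (iii) if a dead end $e$ incident to a vertex $v$ has $q(e,v)=1$ then $v$ is dicritical; (iv) every vertex $\ne v_0$ has valency $\ne2$. **Notation.** $\mathcal N=\{v\in\mathcal V:N_v>0\}$ (a subtree containing $v_0$; an edge of $\mathcal N$ is an edge with both endpoints in $\mathcal N$). $\mathcal D_v$: set of dicritical vertices adjacent to $v$. Degree $d_u$ of a dicritical $u$: number of $(1)$-arrows adjacent to $u$. For a dicritical $u$, $k_u=-\det(\{u,v\})$ where $v$ is the unique vertex adjacent to $u$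 (one has $v\in\mathcal N$). $v\in\mathcal N$ is a node if $\mathcal D_v\neq\emptyset$. $a_v=q(e,v)$ if a dead end $e$ is incident to $v$, $a_v=1$ otherwise. $r_v=-1+$ (number of vertices adjacent to $v$). $\epsilon(v)$: number of elements of $\mathcal N$ adjacent to $v$. For $v\in\mathcal N$: $\widetilde\Delta(v)=(r_v-1)(N_v-1)+N_v(1-\frac1{a_v})-\sum_{u\in\mathcal D_v}(d_u-1)$, and $\widetilde\Delta(S)=\sum_{v\in S}\widetilde\Delta(v)$ for $S\subseteq\mathcal N$. $d(v)=N_v$ if $v$ is not a node, $d(v)=\gcd\{d_u:u\in\mathcal D_v\}$ if $v$ is a node. **Characteristic numbers.** $P$ is the set of pairs $(u,e)$ with $u\in\mathcal N$ and $e$ an edge of $\mathcal N$ incident to $u$. Let $(u,e)\in P$, $e=\{u,u_0\}$. If $\epsilon(u_0)=1$, $c(u,e)=d(u_0)/a_{u_0}$. Otherwise, with $u,u_1,\dots,u_n$ the elements of $\mathcal N$ adjacent to $u_0$ and $e_i=\{u_0,u_i\}$, $c(u,e)=\gcd(d(u_0),c(u_0,e_1),\dots,c(u_0,e_n))/a_{u_0}$, where the gcd of rationals is the nonnegative generator of the $\mathbb Z$-module they generate. The $c(u,e)$ are positive rationals; $M(u,e)=N_u/c(u,e)$. For $(u,e)\in P$: $\mathcal N(u,e)=\{x\in\mathcal N: e\text{ is in }\gamma_{u,x}\}$ and $\eta(u,e)=\widetilde\Delta(\mathcal N(u,e))-(1-c(u,e))$. For $u\in\mathcal N$, $\mathcal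 E_u$ is the set of edges of $\mathcal N$ incident to $u$, and for $A\subseteq\mathcal E_u$: $\bar\Delta(u,A)=\widetilde\Delta\big(\{u\}\cup\bigcup_{e\in A}\mathcal N(u,e)\big)$ and $R(u,A)=\sum_{x\in\mathcal D_u}(1-\frac1{k_x})+(1-\frac1{a_u})+\sum_{e\in A}(1-\frac1{M(u,e)})$. *)

(* Defs.v *)
From HB Require Import structures.
From mathcomp Require Import all_boot all_order all_algebra.

Set Implicit Arguments.
Unset Strict Implicit.
Unset Printing Implicit Defensive.

Import Order.TTheory GRing.Theory Num.Theory.
Local Open Scope ring_scope.

(** * Rooted trees *)

Definition edge_rel (X : finType) (E : {set {set X}}) : rel X :=
  fun x y => [set x; y] \in E.

Record rooted_tree := RootedTree {
  cell :> finType;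
  edges : {set {set cell}};
  troot : cell;
  edges_card : forall e, e \in edges -> #|e| = 2%N;
  tree_connected : forall x y, connect (edge_rel edges) x y;
  (* a cycle needs at least three cells: [:: x; y] with x, y adjacent is
     a ucycle for any symmetric relation *)
  tree_acyclic : forall p : seq cell,
    ucycle (edge_rel edges) p -> (size p <= 2)%N }.

Section RootedTree.
Variable T : rooted_tree.
Implicit Types (x y z : T) (e : {set T}) (p : seq T).

Definition adj : rel T := edge_rel (edges T).

Definition valency x : nat := #|[set e in edges T | x \in e]|.

Definition simple_path x y p :=
  [&& path adj x p, last x p == y & uniq (x :: p)].

Lemma simple_path_exists x y : exists p, simple_path x y p.
Proof.
have /connectP[p xp ->] := tree_connected x y.
by case/shortenP: xp => p' xp' up' _; exists p'; rewrite /simple_path xp' eqxx.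
Qed.

(* The sequence of cells of the path from x to y, both ends included. *)
Definition gamma x y : seq T := x :: xchoose (simple_path_exists x y).

Fixpoint path_edges p : seq {set T} :=
  if p is x :: p' then
    if p' is y :: _ then [set x; y] :: path_edges p' else [::]
  else [::].

Definition gamma_edges x y : seq {set T} := path_edges (gamma x y).

Lemma adjC x y : adj x y = adj y x.
Proof. by rewrite /adj /edge_rel setUC. Qed.

Lemma adj_irrefl x : adj x x = false.
Proof.
apply/negP => /(@edges_card T).
by rewrite setUid cards1.
Qed.

Lemma simple_path_uniq x y p1 p2 :
  simple_path x y p1 -> simple_path x y p2 -> p1 = p2.
Proof.
elim: p1 p2 x => [|a p1 IH] [|b p2] x //=.
- case/and3P=> _ /eqP<- _ /and3P[_ /eqP/= xE /andP[/negP[]]].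
  by rewrite -{1}xE mem_last.
- case/and3P=> _ /eqP/= xE /andP[xNp _] /and3P[_ /eqP/= xy _].
  by case/negP: xNp; rewrite xy -xE mem_last.
case/and3P=> /= /andP[xa ap1] l1 /andP[xN1 u1].
case/and3P=> /= /andP[xb bp2] l2 /andP[xN2 u2].
have [ab|a_neq_b] := eqVneq a b.
  by subst b; congr (_ :: _); apply: (IH _ a); apply/and3P.
exfalso.
have [r [ar lr xr]] : exists r, [/\ path adj a r, last a r = b & x \notin a :: r].
  exists (p1 ++ rev (belast b p2)); split.
  - rewrite cat_path ap1 (eqP l1) -(eqP l2) rev_path.
    by rewrite (eq_path (e' := adj)) // => u v; rewrite adjC.
  - rewrite last_cat (eqP l1) -(eqP l2); case: (p2) => //= c s.
    by rewrite rev_cons last_rcons.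
  - rewrite -cat_cons mem_cat negb_or xN1 mem_rev.
    by apply: contra xN2 => /mem_belast.
case/shortenP: ar lr xr => s as_ us ss lr xr.
have : ucycle adj (x :: a :: s).
  apply/andP; split.
    by rewrite /= xa rcons_path as_ lr adjC xb.
  rewrite cons_uniq us andbT; apply: contra xr.
  by rewrite !inE => /orP[->//|/ss ->]; rewrite orbT.
move/tree_acyclic => /=; case: s lr {as_ us ss} => //= ab _.
by rewrite ab eqxx in a_neq_b.
Qed.

Lemma gammaE x y p : simple_path x y p -> gamma x y = x :: p.
Proof.
by move=> sp; congr (_ :: _); apply: simple_path_uniq sp; apply: xchooseP.
Qed.

(* Arrows, vertices, and the strict order x < y. *)
Definition arrows : {set T} := [set x | (valency x == 1%N) && (x != troot T)].
Definition vertices : {set T} := ~: arrows.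
Definition below x y := (x != y) && (x \in gamma (troot T) y).

(* E_v^+ *)
Definition upper_edges x : {set {set T}} :=
  [set e in edges T | [exists y, (e == [set x; y]) && below x y]].

(* The end of the edge e that is not x. *)
Definition other_end x e : T := odflt x [pick y in e :\ x].

End RootedTree.

(** * Decorated rooted trees *)

(* [dec_one a] means that the arrow a is decorated by (1), [~~ dec_one a] that it is
   decorated by (0); its values at vertices are irrelevant.  Likewise [qdec e x]
   is meaningful only for an edge e and x \in e. *)
Record decorated_tree := DecoratedTree {
  dtree :> rooted_tree;
  dec_one : pred dtree;
  qdec : {set dtree} -> dtree -> int }.

Section DecoratedTree.
Variable T : decorated_tree.
Implicit Types (u v w x y z : T) (e : {set T}).

Definition arrows0 : {set T} := [set a in arrows T | ~~ dec_one a].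
Definition arrows1 : {set T} := arrows T :\: arrows0.

Definition Qprod e x : int :=
  \prod_(e' in edges T | (x \in e') && (e' != e)) qdec e' x.

(* det of the edge {x, y} *)
Definition edge_det x y : int :=
  let e := [set x; y] in qdec e x * qdec e y - Qprod e x * Qprod e y.

Definition dead_ends : {set {set T}} :=
  [set e in edges T | [exists a in arrows0, a \in e]].

Record abstract_newton_tree : Prop := AbstractNewtonTree {
  ant_arrow_above : forall v, v \in vertices T ->
    exists2 a, a \in arrows1 & below v a;
  ant_dead_end_uniq : forall v e e', v \in vertices T ->
    e \in dead_ends -> e' \in dead_ends -> v \in e -> v \in e' -> e = e';
  ant_root : forall e, e \in edges T -> troot T \in e -> qdec e (troot T) = 1;
  ant_arrow : forall e a, e \in edges T -> a \in arrows T -> a \in e ->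
    qdec e a = 1;
  ant_coprime : forall v e e', v \in vertices T ->
    e \in edges T -> e' \in edges T -> v \in e -> v \in e' -> e != e' ->
    coprimez (qdec e v) (qdec e' v);
  ant_upper_ge1 : forall v e, v \in vertices T -> e \in upper_edges v ->
    1 <= qdec e v;
  ant_upper_gt1 : forall v e e', v \in vertices T ->
    e \in upper_edges v -> e' \in upper_edges v ->
    1 < qdec e v -> 1 < qdec e' v -> e = e';
  (* qdec(epsilon, v) is the maximum of the qdec(e, v), e in E_v^+ *)
  ant_dead_end_max : forall v eps, v \in vertices T ->
    eps \in dead_ends -> v \in eps ->
    (exists2 e, e \in upper_edges v & qdec e v = qdec eps v) /\
    (forall e, e \in upper_edges v -> qdec e v <= qdec eps v);
  ant_det : forall x y, x \in vertices T -> y \in vertices T -> adj x y ->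
    edge_det x y < 0 }.

(* x_{v,a} *)
Definition xprod v a : int :=
  \prod_(z <- gamma v a)
    \prod_(e in edges T | (z \in e) && (e \notin gamma_edges v a)) qdec e z.

(* N_v *)
Definition mult v : int := \sum_(a in arrows1) xprod v a.

Definition dicriticals : {set T} := [set v in vertices T | mult v == 0].

Record minimally_complete : Prop := MinimallyComplete {
  mc_mult_ge0 : forall v, v \in vertices T -> 0 <= mult v;
  mc_arrow1 : forall a, a \in arrows1 -> exists2 v, v \in dicriticals & adj v a;
  mc_dicritical : forall v, v \in dicriticals ->
    exists2 e, e \in dead_ends & v \in e;
  mc_dead_end1 : forall v e, v \in vertices T -> e \in dead_ends -> v \in e ->
    qdec e v = 1 -> v \in dicriticals;
  mc_valency : forall v, v \in vertices T -> v != troot T -> valency v <> 2%N }.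

(* The set N of vertices with N_v > 0. *)
Definition posverts : {set T} := [set v in vertices T | 0 < mult v].

(* D_v *)
Definition dicr_nbrs v : {set T} := [set x in dicriticals | adj v x].

(* d_u, for u dicritical *)
Definition degree u : nat := #|[set a in arrows1 | adj u a]|.

(* k_u, for u dicritical *)
Definition kdet u : int :=
  if [pick v in vertices T | adj u v] is Some v then - edge_det u v else 0.

Definition is_node v := dicr_nbrs v != set0.

(* a_v *)
Definition adec v : int :=
  if [pick e in dead_ends | v \in e] is Some e then qdec e v else 1.

(* r_v *)
Definition rnum v : int := #|[set x in vertices T | adj v x]|%:Z - 1.

Definition pos_nbrs v : {set T} := [set x in posverts | adj v x].

(* epsilon(v) *)
Definition eps v : nat := #|pos_nbrs v|.

Definition Delta v : rat :=
  ((rnum v - 1) * (mult v - 1))%:~R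
  + (mult v)%:~R * (1 - 1 / (adec v)%:~R)
  - \sum_(x in dicr_nbrs v) ((degree x)%:R - 1).

Definition DeltaS (S : {set T}) : rat := \sum_(v in S) Delta v.

(* d(v), for v in N *)
Definition dnum v : int :=
  if is_node v then (\big[gcdn/0%N]_(x in dicr_nbrs v) degree x)%:Z
  else mult v.

(* E_u *)
Definition pos_edges u : {set {set T}} :=
  [set e in edges T | (u \in e) && (e \subset posverts)].

(* N(u, e) *)
Definition branch u e : {set T} :=
  [set x in posverts | e \in gamma_edges u x].

End DecoratedTree.

(** * Gcd of rational numbers *)

Definition gcdq (a b : rat) : rat :=
  (gcdz (numq a * denq b) (numq b * denq a))%:~R / (denq a * denq b)%:~R.

Definition gcdqs (s : seq rat) : rat := foldr gcdq 0 s.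

Lemma gcdqs_ge0 s : 0 <= gcdqs s.
Proof.
by case: s => //= a s; rewrite divr_ge0 ?ler0z // mulr_ge0 ?denq_ge0.
Qed.

Lemma gcdq_span a b x :
  (exists m n : int, x = a *~ m + b *~ n) <-> exists m : int, x = gcdq a b *~ m.
Proof.
set D : rat := (denq a * denq b)%:~R.
have D0 : D != 0 by rewrite intr_eq0 mulf_neq0 ?denq_neq0.
set A := numq a * denq b; set B := numq b * denq a.
have aE : a = A%:~R / D.
  by rewrite /A /D !intrM -mulf_div divff ?intr_eq0 ?denq_neq0 // mulr1 divq_num_den.
have bE : b = B%:~R / D.
  rewrite /B /D (mulrC (denq a)) !intrM -mulf_div divff ?intr_eq0 ?denq_neq0 //.
  by rewrite mulr1 divq_num_den.
have gE : gcdq a b = (gcdz A B)%:~R / D by [].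
have zE (m : int) (z : int) : (z%:~R / D) *~ m = (m * z)%:~R / D.
  by rewrite -mulrzl mulrA -intrM.
rewrite gE aE bE; clearbody A B D; split=> [[m [n ->]]|[m ->]].
  have /dvdzP[A' AE] := dvdz_gcdl A B; have /dvdzP[B' BE] := dvdz_gcdr A B.
  exists (m * A' + n * B'); rewrite !zE -mulrDl -intrD; congr (_%:~R / _).
  by rewrite mulrDl -!mulrA -AE -BE.
have [v [w vw]] := Bezoutz A B.
exists (m * v), (m * w); rewrite !zE -vw -mulrDl -intrD; congr (_%:~R / _).
by rewrite mulrDr !mulrA.
Qed.

(* Together with [gcdqs_ge0]: [gcdqs s] is the nonnegative generator of the
   Z-module generated by s. *)
Lemma gcdqs_span s x :
  inIntSpan (in_tuple s) x <-> exists m : int, x = gcdqs s *~ m.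
Proof.
rewrite /inIntSpan /=; elim: s x => [|a s IH] x /=.
  split=> [[c ->]|[m ->]]; first by exists 0; rewrite big_ord0.
  by exists [ffun=> 0]; rewrite big_ord0 mul0rz.
apply: (iff_trans _ (gcdq_span a (gcdqs s) x)); split=> [[c]|[m [n ->]]].
  rewrite big_ord_recl /= => ->.
  have [n nE] : exists n, \sum_(i < size s) s`_i *~ c (lift ord0 i) = gcdqs s *~ n.
    by apply/IH; exists [ffun i => c (lift ord0 i)]; apply: eq_bigr => i _; rewrite ffunE.
  by exists (c ord0), n; rewrite -nE.
have [c ->] : exists c : int ^ size s, gcdqs s *~ n = \sum_(i < size s) s`_i *~ c i.
  by apply/IH; exists n.
exists [ffun i => oapp c m (unlift ord0 i)]; rewrite big_ord_recl /= ffunE unlift_none /=.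
by congr (_ + _); apply: eq_bigr => i _; rewrite ffunE liftK.
Qed.

(** * Characteristic numbers *)

Section CharacteristicNumbers.
Variable T : decorated_tree.
Implicit Types (u w x : T) (e : {set T}) (A : {set {set T}}).

(* c(u, {u, u0}), by recursion on a bound on the size of the branch at u that
   contains u0; see [charnumE]. *)
Fixpoint charnum_rec (n : nat) u u0 : rat :=
  if n is n'.+1 then
    if eps u0 == 1%N then (dnum u0)%:~R / (adec u0)%:~R
    else gcdqs ((dnum u0)%:~R ::
                [seq charnum_rec n' u0 w | w <- enum (pos_nbrs u0 :\ u)])
         / (adec u0)%:~R
  else 0.

Definition charnum u u0 : rat := charnum_rec #|T| u u0.

Let far u u0 : {set T} := [set x | [set u; u0] \in gamma_edges u x].

Let far_self u u0 : adj u u0 -> u0 \in far u u0.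
Proof.
move=> uu0; rewrite inE /gamma_edges (@gammaE _ _ _ [:: u0]) ?mem_head //.
rewrite /simple_path /= uu0 eqxx inE !andbT.
by apply: contraTneq uu0 => ->; rewrite adj_irrefl.
Qed.

Let path_edges_sub (p : seq T) e x : e \in path_edges p -> x \in e -> x \in p.
Proof.
elim: p => [|a [|b p] IH] //; rewrite [path_edges _]/= inE => /orP[/eqP-> | ep xe].
  by rewrite !inE => /orP[]->; rewrite ?orbT.
by rewrite in_cons IH ?orbT.
Qed.

Let far_proper u u0 w :
  adj u u0 -> adj u0 w -> w != u -> far u0 w \proper far u u0.
Proof.
move=> uu0 u0w wu; apply/properP; split; last first.
  exists u0; rewrite ?far_self // inE /gamma_edges (@gammaE _ _ _ [::]) //.
  by rewrite /simple_path /= eqxx.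
apply/subsetP=> x; rewrite !inE /gamma_edges.
have [p sp] := simple_path_exists u0 x; rewrite (gammaE sp).
case: p sp => [|b p] //= /and3P[/= /andP[u0b bp] lp /andP[u0N up]].
rewrite in_cons => /orP[/eqP/setP ewb|]; last first.
  move=> ep; have := path_edges_sub (p := b :: p) ep (set21 _ _).
  by rewrite (negPf u0N).
have wb : w = b.
  have := ewb w; rewrite !inE eqxx orbT => /esym/orP[/eqP wu0|/eqP //].
  by move: u0w; rewrite wu0 adj_irrefl.
subst b; have uNu0 : u != u0.
  by apply: contraTneq uu0 => ->; rewrite adj_irrefl.
have uNp : u \notin w :: p.
  have {}up : uniq (w :: p) by [].
  apply/negP=> /splitPl H; case: H bp lp up u0N => p1 p2 uE.
  rewrite cat_path -!cat_cons cat_uniq => /andP[wp1 _] _ /andP[uwp1 _].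
  rewrite mem_cat negb_or => /andP[u0N1 _].
  have s1 : simple_path u0 u (w :: p1).
    by apply/and3P; split; [rewrite /= u0w | rewrite /= uE | rewrite cons_uniq u0N1].
  have s2 : simple_path u0 u [:: u].
    by rewrite /simple_path /= eqxx inE adjC uu0 eq_sym uNu0.
  by case: (simple_path_uniq s1 s2) => wE; rewrite wE eqxx in wu.
suff sp : simple_path u x [:: u0, w & p].
  change ([set u; u0] \in path_edges (gamma u x)).
  by rewrite (gammaE sp) mem_head.
apply/and3P; split; [by rewrite /= uu0 u0w | by [] |].
by rewrite 2!cons_uniq u0N in_cons negb_or uNu0 uNp.
Qed.

Let charnum_rec_stable n m u u0 : adj u u0 ->
  (#|far u u0| <= n)%N -> (#|far u u0| <= m)%N ->
  charnum_rec n u u0 = charnum_rec m u u0.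
Proof.
have far_gt0 a b : adj a b -> (0 < #|far a b|)%N.
  by move=> ab; apply/card_gt0P; exists b; apply: far_self.
elim: n m u u0 => [|n IH] [|m] u u0 uu0; rewrite ?leqn0.
- by [].
- by rewrite -leqn0 leqNgt far_gt0.
- by move=> _; rewrite -leqn0 leqNgt far_gt0.
move=> ln lm /=; case: ifP => // _; congr (gcdqs (_ :: _) / _).
apply/eq_in_map => w; rewrite mem_enum !inE => /and3P[wu _ u0w].
have lt := proper_card (far_proper uu0 u0w wu).
by apply: IH => //; rewrite -ltnS; apply: leq_trans lt _.
Qed.

Lemma charnumE u u0 : adj u u0 ->
  charnum u u0 =
    if eps u0 == 1%N then (dnum u0)%:~R / (adec u0)%:~R
    else gcdqs ((dnum u0)%:~R ::
                [seq charnum u0 w | w <- enum (pos_nbrs u0 :\ u)])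
         / (adec u0)%:~R.
Proof.
move=> uu0; rewrite {1}/charnum.
rewrite (@charnum_rec_stable _ #|T|.+1 u u0 uu0) ?max_card //.
exact/leqW/max_card.
Qed.

(* c(u, e) *)
Definition cnum u e : rat := charnum u (other_end u e).

(* M(u, e) *)
Definition Mnum u e : rat := (mult u)%:~R / cnum u e.

(* eta(u, e) *)
Definition eta u e : rat := DeltaS (branch u e) - (1 - cnum u e).

Definition barDelta u A : rat := DeltaS (u |: \bigcup_(e in A) branch u e).

Definition Rnum u A : rat :=
  \sum_(x in dicr_nbrs u) (1 - 1 / (kdet x)%:~R)
  + (1 - 1 / (adec u)%:~R)
  + \sum_(e in A) (1 - 1 / Mnum u e).

End CharacteristicNumbers.

(* Main.v *)
Require Import Defs.
From mathcomp Require Import all_boot all_order all_algebra.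
From mathcomp Require Import ring.
Set Implicit Arguments.
Unset Strict Implicit.
Unset Printing Implicit Defensive.
Import Order.TTheory GRing.Theory Num.Theory.
Local Open Scope ring_scope.

(** Multiply the identity by N_u and split the branches N(u, e), e in A, off the
    set defining barDelta(u, A) (they are pairwise disjoint and miss u).  The
    terms Delta(N(u, e)) cancel against those of eta(u, e), the terms c(u, e)
    cancel because 1/M(u, e) = c(u, e)/N_u, and the terms in a_u agree.  Since
    r_u = epsilon(u) + |D_u| - 1 (a vertex adjacent to u either has positive
    multiplicity or is dicritical), all that remains is

      sum_(x in D_u) N_u / k_x = sum_(x in D_u) d_x,

    and this holds term by term: N_u = k_x d_x for every dicritical x adjacent
    to u ([kdet_degree]).

    The last equality rests on one relation ([det_mult]).  For an edge
    e = {x, y}, let S be the sum over the (1)-arrows a on the side of y of the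
    part of x_{x,a} contributed by the cells from y on.  For such an arrow
    x_{x,a} = Q(e,x) w and x_{y,a} = q(e,y) w, where w is the contribution of a
    to S, and for the other arrows q(e,x) x_{y,a} = Q(e,y) x_{x,a}.  Hence

      det(e) S = q(e,x) N_y - Q(e,y) N_x.

    Along a path going away from the root only decorations of upper edges
    contribute, so S > 0 when y is above x.  If moreover N_x = 0, then
    det(e) < 0 forces N_y < 0, a contradiction: no vertex lies above a
    dicritical vertex ([dicritical_child]).  So a dicritical x has only its
    parent u as adjacent vertex.  The dead end at x and coprimality force the
    edges from x to (1)-arrows to have decoration 1 at x
    ([dicritical_arrow_dec]), so S = d_x Q(e,x) for e = {u, x}, and the relation
    reads -k_x d_x Q(e,x) = -Q(e,x) N_u, where Q(e,x) > 0. *)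

(** * Paths in a rooted tree *)

Lemma path_edges_sub (T : rooted_tree) (p : seq T) e x :
  e \in path_edges p -> x \in e -> x \in p.
Proof.
elim: p => [|a [|b p] IH] //; rewrite [path_edges _]/= inE => /orP[/eqP-> | ep xe].
  by rewrite !inE => /orP[]->; rewrite ?orbT.
by rewrite in_cons IH ?orbT.
Qed.

Lemma adj_neq (T : rooted_tree) (x y : T) : adj x y -> x != y.
Proof. by apply: contraTneq => ->; rewrite adj_irrefl. Qed.

Lemma edgeP (T : rooted_tree) (e : {set T}) x :
  e \in edges T -> x \in e -> exists2 y, adj x y & e = [set x; y].
Proof.
move=> eE xe; have /eqP/cards2P[a [b [ab eab]]] := edges_card eE.
move: xe; rewrite eab !inE => /orP[]/eqP->.
  by exists b => //; rewrite /adj /edge_rel -eab.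
by exists a; rewrite 1?setUC // /adj /edge_rel setUC -eab.
Qed.

Lemma set2_injr (T : finType) (x y z : T) :
  [set x; y] = [set x; z] -> y = z.
Proof.
move=> /setP H; have := H y; have := H z; rewrite !inE !eqxx !orbT.
have [->|_ /= /eqP->//] := eqVneq z x.
by move=> _; rewrite orbb => /esym/eqP.
Qed.

Lemma simple_gamma (T : rooted_tree) (x y : T) :
  exists2 p, gamma x y = x :: p & simple_path x y p.
Proof. by have [p sp] := simple_path_exists x y; exists p => //; apply: gammaE. Qed.

Lemma gamma_self (T : rooted_tree) (x : T) : gamma x x = [:: x].
Proof. by apply: gammaE; rewrite /simple_path /= eqxx. Qed.

Lemma gamma_adj (T : rooted_tree) (x y : T) : adj x y -> gamma x y = [:: x; y].
Proof.
by move=> xy; apply: gammaE; rewrite /simple_path /= xy eqxx inE adj_neq.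
Qed.

Lemma gamma_uniq (T : rooted_tree) (x y : T) : uniq (gamma x y).
Proof. by have [p -> /and3P[]] := simple_gamma x y. Qed.

Lemma gamma_suffix (T : rooted_tree) (x y z : T) p1 p2 :
  gamma x z = p1 ++ y :: p2 -> gamma y z = y :: p2.
Proof.
have [p -> /and3P[pp lp up]] := simple_gamma x z => pE.
apply: gammaE; apply/and3P; split.
- case: p1 pE => [[<- <-]|a p1 [_ pE]] //.
  by move: pp; rewrite pE cat_path /= => /and3P[].
- by rewrite -(eqP lp) -[last x p]/(last x (x :: p)) pE last_cat.
by move: up; rewrite pE cat_uniq => /and3P[].
Qed.

Lemma gamma_rev (T : rooted_tree) (x y : T) : gamma y x = rev (gamma x y).
Proof.
have [p -> /and3P[pp /eqP lp up]] := simple_gamma x y.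
rewrite lastI rev_rcons lp; apply: gammaE; apply/and3P; split.
- by rewrite -lp rev_path; rewrite (eq_path (e' := @adj T)) // => a b; rewrite adjC.
- by case: p {pp up} lp => [<-|a p] //= _; rewrite rev_cons last_rcons.
by rewrite -rev_rcons -{1}lp -lastI rev_uniq.
Qed.

(** The path from one end of an edge to z either starts with that edge or is
    obtained from the path of the other end by deleting its first cell; all
    case analyses on the position of a cell relative to an edge use this. *)
Lemma gamma_step (T : rooted_tree) (x y z : T) : adj x y ->
  gamma x z = x :: gamma y z \/ gamma y z = y :: gamma x z.
Proof.
move=> xy; have [p pE sp] := simple_gamma y z; case/and3P: (sp) => pp lp up.
have [xp|xNp] := boolP (x \in y :: p); last first.
  by left; rewrite pE; apply: gammaE; apply/and3P; rewrite cons_uniq xNp /= xy.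
right; move: xp; rewrite in_cons (negPf (adj_neq xy)) /= => xp.
have pN : p = x :: behead p.
  have [q [r qr]] : exists q r, p = rcons q x ++ r.
    by case/splitPr: xp => q r; exists q, r; rewrite cat_rcons.
  have : gamma y x = y :: rcons q x.
    apply: gammaE; apply/and3P; split; last 2 first.
    - by rewrite last_rcons.
    - by move: up; rewrite qr -cat_cons cat_uniq => /andP[].
    by move: pp; rewrite qr cat_path => /andP[].
  by rewrite gamma_adj 1?adjC // qr => -[<-].
rewrite pE pN; congr cons; apply/esym/(@gamma_suffix T y _ _ [:: y]).
by rewrite pE {1}pN.
Qed.

(** * Children and ascending paths *)

(** A covering pair of the order x < y, phrased with paths towards the root so
    that the parent of y can be read off as the second cell of such a path. *)
Definition child (T : rooted_tree) (x y : T) :=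
  gamma y (troot T) == y :: gamma x (troot T).

Lemma child_adj (T : rooted_tree) (x y : T) : child x y -> adj x y.
Proof.
rewrite /child; have [p -> /and3P[]] := simple_gamma y (troot T).
have [q -> _] := simple_gamma x (troot T).
by move=> + _ _ /eqP[pE]; rewrite pE adjC /= => /andP[].
Qed.

Lemma child_below (T : rooted_tree) (x y : T) : child x y -> below x y.
Proof.
move=> xy; rewrite /below adj_neq ?child_adj //= gamma_rev mem_rev (eqP xy).
by rewrite in_cons /gamma mem_head orbT.
Qed.

Lemma child_uniq (T : rooted_tree) (x x' y : T) :
  child x y -> child x' y -> x = x'.
Proof. by rewrite /child => /eqP-> /eqP[]. Qed.

Lemma adj_child (T : rooted_tree) (x y : T) : adj x y -> child x y \/ child y x.
Proof.
by move=> /(@gamma_step _ x y (troot T))[] xy; [right|left]; apply/eqP.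
Qed.

(** A path that once goes away from the root keeps doing so: turning back would
    mean stepping to the parent, which is the cell it has just left. *)
Lemma path_child (T : rooted_tree) (x y : T) p :
  child x y -> path (@adj T) y p -> uniq [:: x, y & p] -> path (@child T) x (y :: p).
Proof.
elim: p x y => [|z p IH] x y xy; first by rewrite /= xy.
move=> /= /andP[yz pz] /and3P[xN yN up]; rewrite xy /=.
apply: IH => //=; last by rewrite yN.
case: (adj_child yz) => // zy; move: xN.
by rewrite (child_uniq xy zy) !inE eqxx orbT.
Qed.

Lemma upper_edge_child (T : rooted_tree) (x y : T) :
  child x y -> [set x; y] \in upper_edges x.
Proof.
move=> xy; rewrite inE; apply/andP; split; first exact: child_adj.
by apply/existsP; exists y; rewrite eqxx child_below.
Qed.

(** The only edge at z that is not upper joins z to its parent, and an ascending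
    path reaches z through that edge. *)
Lemma off_path_upper (T : rooted_tree) (x z : T) p e :
  path (@child T) x p -> z \in p -> e \in edges T -> z \in e ->
  e \notin path_edges (x :: p) -> e \in upper_edges z.
Proof.
move=> + + eE ze; elim: p x => [|y p IH] x //= /andP[xy py].
rewrite !in_cons negb_or => zp /andP[exy]; case/predU1P: zp => [zy _|/IH]; last exact.
have [t zt et] := edgeP eE ze.
case: (adj_child zt) => [/upper_edge_child|tz]; first by rewrite et.
by subst z; move: exy; rewrite et (child_uniq tz xy) setUC eqxx.
Qed.

Lemma arrow_nbr_uniq (T : rooted_tree) (a x : T) e :
  a \in arrows T -> adj a x -> e \in edges T -> a \in e -> e = [set a; x].
Proof.
rewrite inE => /andP[/cards1P[f fE] _] ax eE ae.
have ef : e \in [set f] by rewrite -fE inE eE.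
have : [set a; x] \in [set f] by rewrite -fE inE !inE eqxx andbT.
by rewrite inE in ef; rewrite inE (eqP ef) => /eqP.
Qed.

(** * Multiplicities at the two ends of an edge *)

Section Multiplicities.
Variable T : decorated_tree.
Implicit Types (x y u v a : T).

(** For an edge {x, y} on the path from x to a: the part of x_{x,a} contributed
    by the cells from y on.  The edges excluded are those of the path from x,
    so that {x, y} itself does not count at y. *)
Definition tailprod x y a : int :=
  \prod_(z <- gamma y a)
    \prod_(e in edges T | (z \in e) && (e \notin gamma_edges x a)) qdec e z.

(** The products for x and y share [tailprod] and differ only at the edge
    {x, y}: it is on the path from x, whose other edges at x all contribute, but
    it hangs off the path from y. *)
Lemma xprod_step x y a : adj x y -> gamma x a = x :: gamma y a ->
  xprod x a = Qprod [set x; y] x * tailprod x y a /\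
  xprod y a = qdec [set x; y] y * tailprod x y a.
Proof.
move=> xy xya; have [p yp _] := simple_gamma y a.
have xNp : x \notin y :: p.
  by have := gamma_uniq x a; rewrite xya yp cons_uniq => /andP[].
have yNp : y \notin p.
  by have := gamma_uniq y a; rewrite yp cons_uniq => /andP[].
have xE : gamma_edges x a = [set x; y] :: gamma_edges y a.
  by rewrite /gamma_edges xya yp.
have xyN : [set x; y] \notin gamma_edges y a.
  apply: contra xNp => /path_edges_sub; rewrite -yp; apply.
  by rewrite !inE eqxx.
split.
  rewrite {1}/xprod {1}xya big_cons; congr (_ * _); apply: eq_bigl => e.
  congr (_ && _); case: (boolP (x \in e)) => // xe /=.
  rewrite xE in_cons negb_or andbC -[RHS]andTb; congr (_ && _).
  by apply: contra xNp => /path_edges_sub; rewrite -yp; apply.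
rewrite /xprod /tailprod yp !big_cons mulrA; congr (_ * _).
  rewrite (bigD1 [set x; y]) /=; last by rewrite xyN !inE eqxx orbT /= andbT.
  congr (_ * _); apply: eq_bigl => e; rewrite xE in_cons negb_or.
  by rewrite -!andbA [_ && (e != _)]andbC.
apply: eq_big_seq => z zp; apply: eq_bigl => e; rewrite xE in_cons negb_or.
congr (_ && _); case: (boolP (z \in e)) => // ze /=.
suff -> : e != [set x; y] by [].
apply: contraTneq ze => ->; rewrite !inE negb_or.
apply/andP; split; first by apply: contraNneq xNp => <-; rewrite in_cons zp orbT.
by apply: contraNneq yNp => <-.
Qed.

(** The (1)-arrows separated from x by the edge {x, y}. *)
Definition side x y : {set T} :=
  [set a in arrows1 T | [set x; y] \in gamma_edges x a].

Lemma sideP x y a : adj x y ->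
  a \in side x y <-> a \in arrows1 T /\ gamma x a = x :: gamma y a.
Proof.
move=> xy; rewrite inE; split=> [/andP[-> axy]|[-> ga]]; last first.
  rewrite /gamma_edges ga; have [p -> _] := simple_gamma y a.
  by rewrite mem_head.
split=> //; case: (@gamma_step _ x y a xy) => // ga.
have := path_edges_sub axy (set22 _ _).
by have := gamma_uniq y a; rewrite ga cons_uniq => /andP[/negP].
Qed.

(** An arrow beyond y contributes q(e,x) q(e,y) w - Q(e,y) Q(e,x) w to the
    right-hand side; an arrow on the side of x contributes 0, because then x and
    y exchange their roles in [xprod_step]. *)
Lemma det_mult x y : adj x y ->
  edge_det x y * \sum_(a in side x y) tailprod x y a =
  qdec [set x; y] x * mult y - Qprod [set x; y] y * mult x.
Proof.
move=> xy; rewrite /mult !mulr_sumr -sumrB.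
rewrite [RHS](bigID (mem (side x y))) /= [X in _ = _ + X]big1 ?addr0; last first.
  move=> a /andP[a1 aN]; case: (gamma_step a xy) => ga.
    by case/negP: aN; apply/sideP.
  rewrite adjC in xy; have [-> ->] := xprod_step xy ga.
  by rewrite setUC; ring.
apply: eq_big => [a|a /sideP[//|a1 ga]].
  by rewrite inE; case: (a \in arrows1 T).
have [-> ->] := xprod_step xy ga; rewrite /edge_det; ring.
Qed.

Lemma edge_detC x y : edge_det x y = edge_det y x.
Proof. by rewrite /edge_det setUC; ring. Qed.

(** * Positivity along ascending paths *)

Hypothesis hT : abstract_newton_tree T.


Lemma prod_ge1 (I : Type) (r : seq I) (P : pred I) (F : I -> int) :
  (forall i, P i -> 1 <= F i) -> 1 <= \prod_(i <- r | P i) F i.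
Proof. by move=> F1; elim/big_ind: _ => //; apply: mulr_ege1. Qed.

Lemma sum_ge1_gt0 (I : finType) (S : {set I}) (F : I -> int) i :
  i \in S -> (forall j, j \in S -> 1 <= F j) -> 0 < \sum_(j in S) F j.
Proof.
move=> iS F1; rewrite (bigD1 i) //= ltr_pwDl ?(lt_le_trans _ (F1 i iS)) //.
by apply: sumr_ge0 => j /andP[/F1 jS _]; apply: le_trans jS.
Qed.

Lemma upper_ge1 (e : {set T}) z : e \in upper_edges z -> z \in e -> 1 <= qdec e z.
Proof.
move=> eU ze; have [zV|] := boolP (z \in vertices T).
  exact: (ant_upper_ge1 hT zV).
rewrite inE negbK => za; move: eU; rewrite inE => /andP[eE _].
by rewrite (ant_arrow hT eE za).
Qed.

Lemma tailprod_ge1 x y a : child x y -> gamma x a = x :: gamma y a ->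
  1 <= tailprod x y a.
Proof.
move=> xy ga; rewrite /tailprod big_seq; apply: prod_ge1 => z za.
apply: prod_ge1 => e /andP[eE /andP[ze eN]]; apply: upper_ge1 => //.
apply: (@off_path_upper T x z (gamma y a)) => //; last by rewrite -ga.
have := gamma_uniq x a; rewrite ga; have [p -> /and3P[yp _ _]] := simple_gamma y a.
exact: path_child.
Qed.

(** Condition (1) provides an arrow above y; its path to the root goes through
    y and then the parent x, so reversing it shows that {x, y} separates it
    from x. *)
Lemma side_nonempty x y : child x y -> y \in vertices T ->
  exists a, a \in side x y.
Proof.
move=> xy yV; have [a aA /andP[_]] := ant_arrow_above hT yV.
rewrite gamma_rev mem_rev => ya; exists a; apply/sideP; first exact: child_adj.
split=> //; have [p1 [p2 aE]] : exists p1 p2, gamma a (troot T) = p1 ++ y :: p2.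
  by case/splitPr: ya => p1 p2; exists p1, p2.
have := gamma_suffix aE; rewrite (eqP xy) => -[p2E].
have [p3 xE _] := simple_gamma x (troot T).
have rE : gamma (troot T) a = rev p3 ++ x :: y :: rev p1.
  by rewrite gamma_rev aE -p2E xE rev_cat !rev_cons !cat_rcons.
rewrite (gamma_suffix rE); congr cons; apply/esym.
by apply: (gamma_suffix (p1 := rev p3 ++ [:: x])); rewrite -catA; exact: rE.
Qed.

Lemma Qprod_ge1 x y : child x y -> 1 <= Qprod [set x; y] y.
Proof.
move=> xy; apply: prod_ge1 => e /and3P[eE ye exy]; apply: upper_ge1 => //.
by apply: (@off_path_upper T x y [:: y]); rewrite /= ?xy ?inE.
Qed.

(** * Dicritical vertices *)

Hypothesis hmc : minimally_complete T.

Lemma dicriticalP x : x \in dicriticals T -> x \in vertices T /\ mult x = 0.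
Proof. by rewrite inE => /andP[-> /eqP]. Qed.

(** If y were a child, [det_mult] with N_x = 0 would give
    det(e) S = q(e,x) N_y with S > 0, a negative number equal to a nonnegative
    one. *)
Lemma dicritical_child x y : x \in dicriticals T -> y \in vertices T -> ~~ child x y.
Proof.
move=> /dicriticalP[xV x0] yV; apply/negP => xy; have xya := child_adj xy.
have [a aS] := side_nonempty xy yV.
have S0 : 0 < \sum_(a in side x y) tailprod x y a.
  by apply: (sum_ge1_gt0 aS) => b /(sideP _ xya)[_ gb]; apply: tailprod_ge1.
have := det_mult xya; rewrite x0 mulr0 subr0 => E.
have := ant_det hT xV yV xya; rewrite -(pmulr_llt0 _ S0) E ltNge mulr_ge0 //.
  apply: le_trans (upper_ge1 (upper_edge_child xy) _) => //.
  by rewrite !inE eqxx.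
exact: mc_mult_ge0.
Qed.

Lemma dicritical_parent x u : x \in dicriticals T -> u \in vertices T ->
  adj x u -> child u x.
Proof.
by move=> xD uV /adj_child[] // xu; case/negP: (dicritical_child xD uV).
Qed.

Lemma arrow_child x a : a \in arrows T -> adj x a -> child x a.
Proof.
move=> aA; case/adj_child => // ax.
have aR : a != troot T by move: aA; rewrite inE => /andP[].
have := gamma_uniq x (troot T); rewrite (eqP ax).
have [[|b p] aE /and3P[]] := simple_gamma a (troot T).
  by rewrite /= (negPf aR).
move=> /= /andP[ab _] _ _; rewrite aE.
have /set2_injr -> := arrow_nbr_uniq aA (child_adj ax) (e := [set a; b]) ab (set21 _ _).
by rewrite !inE eqxx orbT.
Qed.

(** The dead end at x carries the maximal decoration among upper edges.  If
    {x, a} had a decoration > 1, it would be the only upper edge with that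
    property, hence would carry the same decoration as the dead end, against
    coprimality. *)
Lemma dicritical_arrow_dec x a : x \in dicriticals T -> a \in arrows1 T ->
  adj x a -> qdec [set x; a] x = 1.
Proof.
move=> xD; rewrite inE => /andP[aN0 aA] xa; have [xV _] := dicriticalP xD.
have xxa : x \in [set x; a] by rewrite !inE eqxx.
have aU := upper_edge_child (arrow_child aA xa).
have q1 := ant_upper_ge1 hT xV aU.
have [e eD xe] := mc_dicritical hmc xD.
have [[f fU fe] /(_ _ aU) qe] := ant_dead_end_max hT xV eD xe.
apply/eqP; rewrite eq_le q1 andbT leNgt; apply/negP => q_gt1.
have fa := ant_upper_gt1 hT xV aU fU q_gt1.
(* the edge f realizing the maximum at the dead end has decoration > 1 as well *)
have {}fa : [set x; a] = f by apply: fa; rewrite fe; apply: lt_le_trans qe.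
have [eE e0] : e \in edges T /\ e != [set x; a].
  move: eD; rewrite inE => /andP[-> /existsP[b /andP[b0 be]]]; split=> //.
  apply: contraTneq be => ->; rewrite !inE negb_or; apply/andP; split.
    apply: contraTneq xV => <-; rewrite inE negbK.
    by move: b0; rewrite inE => /andP[].
  by apply: contraNneq aN0 => <-.
have := ant_coprime hT xV eE (e' := [set x; a]) xa xe xxa e0.
rewrite -fe fa /coprimez gcdzz => /eqP q_abs.
by move: q_gt1; rewrite fa; move: q1 q_abs; rewrite fa; case: (qdec f x) => // n _ [->].
Qed.

(** A path from u through x continues to a neighbour of x other than its parent
    u, which must be an arrow, and the path ends there. *)
Lemma dicritical_side u x : u \in vertices T -> x \in dicriticals T -> adj u x ->
  side u x = [set a in arrows1 T | adj x a].
Proof.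
move=> uV xD ux; have [xV _] := dicriticalP xD.
apply/setP => a; rewrite [RHS]inE; apply/idP/andP.
  move/(sideP _ ux) => [aA ga]; split=> //.
  have [[|b p] xE /and3P[]] := simple_gamma x a.
    move=> _ /= /eqP xa _; move: xV aA.
    by rewrite !inE xa => /negPf->; rewrite andbF.
  move=> /= /andP[xb bp] lp up.
  have ub : b != u.
    apply: contraTneq (gamma_uniq u a) => bu.
    by rewrite ga xE bu cons_uniq !inE eqxx orbT.
  have bA : b \in arrows T.
    apply: contraR ub => bV; have bV' : b \in vertices T by rewrite inE.
    by rewrite (child_uniq (dicritical_parent xD bV' xb)
      (dicritical_parent xD uV _)) // adjC.
  case: p bp lp up {xE} => [_ /eqP<- //|c p /= /andP[bc _] _].
  rewrite adjC in xb.
  have /set2_injr -> := arrow_nbr_uniq bA xb (e := [set b; c]) bc (set21 _ _).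
  by rewrite !inE eqxx !orbT.
move=> [aA xa]; apply/(sideP _ ux); split=> //.
case: (gamma_step a ux) => // ; rewrite (gamma_adj xa) => -[/esym].
have [p -> _] := simple_gamma u a => -[ua _].
by move: uV aA; rewrite !inE ua => /negPf->; rewrite andbF.
Qed.

(** At the arrow there is no other edge, and at x the product differs from
    Q({u, x}, x) only by the factor of {x, a}, which is 1. *)
Lemma dicritical_tailprod u x a : x \in dicriticals T -> a \in arrows1 T ->
  adj u x -> adj x a -> gamma u a = u :: gamma x a ->
  tailprod u x a = Qprod [set u; x] x.
Proof.
move=> xD a1 ux xa ga; have aA : a \in arrows T by move: a1; rewrite inE => /andP[].
have gE : gamma_edges u a = [:: [set u; x]; [set x; a]].
  by rewrite /gamma_edges ga gamma_adj.
have ua : u != a.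
  by have := gamma_uniq u a; rewrite ga gamma_adj //= !inE negb_or => /andP[/andP[]].
rewrite /tailprod gamma_adj // !big_cons big_nil mulr1 [X in _ * X]big1.
  rewrite mulr1 [RHS](bigD1 [set x; a]) /=; last first.
    rewrite set21 [_ && _]/=; apply/andP; split; first exact: xa.
    rewrite eq_sym; apply: contra_neq ua => E.
    by apply: (@set2_injr _ x); rewrite setUC.
  rewrite dicritical_arrow_dec // mul1r; apply: eq_bigl => e.
  by rewrite gE !inE negb_or -!andbA.
move=> e /and3P[eE ae]; rewrite gE !inE negb_or => /andP[_ /negP[]].
by rewrite adjC in xa; rewrite (arrow_nbr_uniq aA xa eE ae) setUC.
Qed.

(** This is [det_mult] for the edge {u, x}, where N_x = 0 and each of the d_x
    arrows beyond x has weight Q({u, x}, x), a factor that cancels. *)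
Lemma kdet_degree u x : u \in vertices T -> x \in dicriticals T -> adj u x ->
  kdet x * (degree x)%:Z = mult u.
Proof.
move=> uV xD ux; have xu : adj x u by rewrite adjC.
have cux := dicritical_parent xD uV xu; have [xV x0] := dicriticalP xD.
have -> : kdet x = - edge_det u x.
  rewrite /kdet; case: pickP => [v /andP[vV xv] | /(_ u)]; last by rewrite uV xu.
  by rewrite (child_uniq (dicritical_parent xD vV xv) cux) edge_detC.
have := det_mult ux; rewrite x0 mulr0 sub0r.
rewrite (eq_bigr (fun=> Qprod [set u; x] x)) => [|a /[dup] aS /(sideP _ ux)[aA ga]].
  rewrite dicritical_side // sumr_const -/(degree x) => H.
  have Q0 : Qprod [set u; x] x != 0 by rewrite gt_eqF // (lt_le_trans _ (Qprod_ge1 cux)).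
  apply: (mulfI Q0); rewrite -[X in _ = X]opprK -H -mulr_natr natz; ring.
apply: dicritical_tailprod => //; move: aS; rewrite dicritical_side // inE.
by case/andP.
Qed.

Lemma rnumE v : rnum v = (eps v)%:Z + #|dicr_nbrs v|%:Z - 1.
Proof.
rewrite /rnum /eps -PoszD; congr (Posz _ - 1).
have <- : pos_nbrs v :|: dicr_nbrs v = [set x in vertices T | adj v x].
  have posE x : (x \in pos_nbrs v) = (x \in vertices T) && (0 < mult x) && adj v x.
    by rewrite 2!inE.
  have dicE x : (x \in dicr_nbrs v) = (x \in vertices T) && (mult x == 0) && adj v x.
    by rewrite 2!inE.
  apply/setP => x; rewrite in_setU posE dicE [RHS]inE -andb_orl -andb_orr.
  congr (_ && _); case: (boolP (x \in vertices T)) => //= xV.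
  by rewrite lt_def (mc_mult_ge0 hmc xV) andbT orNb.
rewrite cardsU.
suff -> : pos_nbrs v :&: dicr_nbrs v = set0 by rewrite cards0 subn0.
apply/eqP; rewrite -subset0; apply/subsetP => x; rewrite !inE lt_def.
by case: (mult x == 0); rewrite ?andbF.
Qed.

End Multiplicities.

(** * Branches *)

Section Branches.
Variable T : decorated_tree.
Implicit Types (u x : T) (e : {set T}) (A : {set {set T}}).

(** A path visits u only at its start, so an edge containing u can only be its
    first edge; this makes branches at u disjoint. *)
Lemma branch_first_edge u e x : u \in e -> x \in branch u e ->
  exists y p, gamma u x = [:: u, y & p] /\ e = [set u; y].
Proof.
rewrite inE /gamma_edges => ue /andP[_].
have [[|y p] -> /and3P[_ _ up]] := simple_gamma u x; first by [].
rewrite [path_edges _]/= in_cons => /predU1P[-> | ep]; first by exists y, p.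
by move: up; rewrite cons_uniq (path_edges_sub (p := y :: p) ep ue).
Qed.

Lemma branch_self u e : u \in e -> u \notin branch u e.
Proof. by move=> ue; apply/negP => /(branch_first_edge ue)[y [p []]]; rewrite gamma_self. Qed.

Lemma branch_disjoint u e e' : u \in e -> u \in e' -> e != e' ->
  [disjoint branch u e & branch u e'].
Proof.
move=> ue ue' ee'; rewrite -setI_eq0 -subset0; apply/subsetP => x.
rewrite inE => /andP[/(branch_first_edge ue)[y [p [gE eE]]]].
case/(branch_first_edge ue') => y' [p' []]; rewrite gE => -[yy' _] eE'.
by rewrite eE eE' yy' eqxx in ee'.
Qed.

Lemma barDeltaE u A : A \subset pos_edges u ->
  barDelta u A = Delta u + \sum_(e in A) DeltaS (branch u e).
Proof.
move=> /subsetP AE; have uA e : e \in A -> u \in e.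
  by move/AE; rewrite inE => /and3P[].
rewrite /barDelta /DeltaS big_setU1 /=; last first.
  by apply/bigcupP => -[e /uA ue]; apply/negP/branch_self.
congr (_ + _); rewrite (big_mkcond (mem A)) /= partition_disjoint_bigcup.
  rewrite [RHS]big_mkcond /=; apply: eq_bigr => e _.
  by case: (e \in A); rewrite ?big_set0.
move=> e e' ee'; case: ifP => eA; last by rewrite -setI_eq0 set0I.
case: ifP => e'A; last by rewrite -setI_eq0 setI0.
by rewrite branch_disjoint ?uA.
Qed.

End Branches.

(** * The identity *)

Theorem theorem4p4 (T : decorated_tree)
    (hT : abstract_newton_tree T) (hmc : minimally_complete T)
    (u : T) (hu : u \in posverts T)
    (A : {set {set T}}) (hA : A \subset pos_edges u) :
  Rnum u A + ((eps u)%:R - #|A|%:R - 1) * (1 - 1 / (mult u)%:~R)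
  = 1 + (barDelta u A - 1 - \sum_(e in A) eta u e) / (mult u)%:~R.
Proof.
move: (hu); rewrite inE => /andP[uV u_gt0].
have N0 : (mult u)%:~R != 0 :> rat by rewrite intr_eq0 gt_eqF.
rewrite barDeltaE // /eta sumrB sumrB /Rnum.
have -> : \sum_(e in A) (1 - 1 / Mnum u e) =
          #|A|%:R - (\sum_(e in A) cnum u e) / (mult u)%:~R.
  rewrite sumrB sumr_const mulr_suml; congr (_ - _); apply: eq_bigr => e _.
  by rewrite div1r /Mnum invf_div.
have -> : \sum_(x in dicr_nbrs u) (1 - 1 / (kdet x)%:~R) =
    #|dicr_nbrs u|%:R - (\sum_(x in dicr_nbrs u) (degree x)%:R) / (mult u)%:~R :> rat.
  rewrite sumrB sumr_const mulr_suml; congr (_ - _); apply: eq_bigr => x.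
  rewrite inE => /andP[xD ux]; rewrite -(kdet_degree hT hmc uV xD ux) intrM.
  have := kdet_degree hT hmc uV xD ux; rewrite -pmulrn => kd.
  have := u_gt0; rewrite -kd => /lt0r_neq0; rewrite mulf_eq0 negb_or => /andP[k0 d0].
  by field; rewrite !intr_eq0 k0 pnatr_eq0; case: (degree x) d0.
rewrite /Delta (rnumE hmc) sumrB !sumr_const !(intrM, intrB, intrD) -!pmulrn.
(* with 1/a_u abstracted, N_u is the only denominator *)
move: (1 / (adec u)%:~R) N0; move: (mult u)%:~R => N a N0.
by field.
Qed.
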